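(* Let $L$ be an invertible linear map on $M_2$ such that $L(S(\mathbb{R}^2_+)) \subset S(\mathbb{R}^2_+)$. Then there exist an invertible row positive matrix $X \in M_2$ and an inverse nonnegative matrix $Y \in M_2$ such that $L(A) = XAY$ for all $A\in M_2$.
   Context: $M_2$ is the space of real $2\times 2$ matrices. A matrix $A\in M_2$ is semipositive if there is $x \in \mathbb{R}^2$ with $x>0$ and $Ax>0$ (componentwise strict inequalities); $S(\mathbb{R}^2_+)$ denotes the set of all semipositive $2\times 2$ matrices. A matrix is row positive if it is entrywise nonnegative and every row contains at least one nonzero entry. A square matrix $Y$ is inverse nonnegative if it is invertible and $Y^{-1}$ is entrywise nonnegative. *)

(* Defs.v *)
From HB Require Import structures.
From mathcomp Require Import all_boot all_order all_algebra.
From mathcomp Require Import classical_sets reals.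
Set Implicit Arguments.
Unset Strict Implicit.
Unset Printing Implicit Defensive.
Import Order.TTheory GRing.Theory Num.Theory.
Local Open Scope ring_scope.
Local Open Scope classical_set_scope.

Definition mx_pos (R : numDomainType) (m n : nat) (A : 'M[R]_(m, n)) : Prop :=
  forall i j, 0 < A i j.

Definition mx_nonneg (R : numDomainType) (m n : nat) (A : 'M[R]_(m, n)) : Prop :=
  forall i j, 0 <= A i j.

Definition semipositive (R : numDomainType) (m n : nat) (A : 'M[R]_(m, n)) : Prop :=
  exists x : 'cV[R]_n, mx_pos x /\ mx_pos (A *m x).

(* The set S(R^n_+) of semipositive n x n matrices. *)
Definition semipositives (R : numDomainType) (n : nat) : set 'M[R]_n :=
  [set A | semipositive A].
Arguments semipositives : clear implicits.

Definition row_positive (R : numDomainType) (m n : nat) (A : 'M[R]_(m, n)) : Prop :=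
  mx_nonneg A /\ (forall i, exists j, A i j != 0).

Definition inverse_nonneg (R : numFieldType) (n : nat) (Y : 'M[R]_n) : Prop :=
  Y \in unitmx /\ mx_nonneg (invmx Y).

(* Main.v *)
Require Import Defs.
From HB Require Import structures.
From mathcomp Require Import all_boot all_order all_algebra.
From mathcomp Require Import classical_sets reals.
From mathcomp Require Import ring lra.
Set Implicit Arguments.
Unset Strict Implicit.
Unset Printing Implicit Defensive.
Import Order.TTheory GRing.Theory Num.Theory.
Local Open Scope ring_scope.
Local Open Scope classical_set_scope.

(** The map is first shown to have the form [A |-> X A Y], and only then are
    the signs of [X] and [Y] read off.

    Form.  A positive row vector [y] never annihilates a semipositive matrix.
    Fix a row [p] orthogonal to some [x > 0] and let [J] be the all-ones
    matrix.  For every column [a] the matrix [J + a p] agrees with [J] on [x],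
    so it is semipositive, and so is its image; thus [y L(a p)] can never equal
    [- y L(J)].  The linear map [a |-> y L(a p)] is therefore not onto, for any
    [y > 0] ([det_pencil_eq0]).  In dimension 2 its determinant is a quadratic
    form in [y], which must vanish identically; a two-dimensional space of
    [2 x 2] matrices with this property is the space of all [b q] for one fixed
    row [q].  Hence [L(a p) = (X a) q] for some matrix [X] and row [q]
    depending on [p] ([image_rank1]).  Comparing this for two independent rows
    and for their sum shows that [X] depends on [p] only up to a scalar, and
    linearity gives [L(A) = X A Y] ([linear_eq_mulmx]).

    Signs.  For [a > 0] and [r] with a positive entry the matrix [a r] is
    semipositive.  So is its image [(X a) (r Y)], which forces [X a] to have
    entries of one strict sign.  Replacing [(X, Y)] by [(- X, - Y)] if needed,
    [X] maps the all-ones column to a positive one; a negative entry of [X]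
    would then make an entry of [X a] vanish for some [a > 0], and a negative
    entry of the inverse of [Y] would give an [r] with a positive entry but
    [r Y <= 0] ([signs_of_preserver]). *)

(** * Degenerate pencils from preservation of semipositivity *)

Lemma semipositive_mul_neq0 (R : numDomainType) (m n : nat)
    (M : 'M[R]_(m.+1, n)) (y : 'rV[R]_m.+1) :
  mx_pos y -> semipositive M -> y *m M != 0.
Proof.
move=> y_gt0 [u [_ Mu_gt0]]; apply: contraTneq isT => yM0.
have: 0 < (y *m (M *m u)) 0 0.
  rewrite mxE big_ord_recl ltr_wpDr ?mulr_gt0 //.
  by apply: sumr_ge0 => i _; rewrite mulr_ge0 // ltW.
by rewrite mulmxA yM0 mul0mx mxE ltxx.
Qed.

Lemma mul_col_delta (R : comPzRingType) (n : nat) (a : 'cV[R]_n) (p : 'rV[R]_n) :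
  a *m p = \sum_i a i 0 *: (delta_mx i 0 *m p).
Proof.
rewrite {1}[a]matrix_sum_delta mulmx_suml; apply: eq_bigr => i _.
by rewrite big_ord1 -scalemxAl.
Qed.

(** If the rows [y L(e_i p)] were independent, some column [b] would satisfy
    [y L(b p) = - y L(J)] with [J] the all-ones matrix; then [y] would
    annihilate the image of [J + b p], a matrix that is semipositive because
    [(J + b p) x = J x > 0]. *)
Lemma det_pencil_eq0 (R : numFieldType) (n : nat)
    (L : {linear 'M[R]_n.+1 -> 'M[R]_n.+1})
    (p y : 'rV[R]_n.+1) (x : 'cV[R]_n.+1) :
  (forall A, semipositive A -> semipositive (L A)) ->
  mx_pos x -> p *m x = 0 -> mx_pos y ->
  \det (\matrix_i (y *m L (delta_mx i 0 *m p))) = 0.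
Proof.
move=> L_semipos x_gt0 px0 y_gt0; apply: contraTeq isT => detD_neq0.
set D := \matrix_i _ in detD_neq0.
have D_unit : D \in unitmx by rewrite unitmxE unitfE.
pose J : 'M[R]_n.+1 := const_mx 1.
pose b := - (y *m L J) *m invmx D.
have bD : y *m L (b^T *m p) = - (y *m L J).
  rewrite -[RHS](mulmxKV D_unit) [in RHS]mulmx_sum_row mul_col_delta (linear_sum L) mulmx_sumr.
  by apply: eq_bigr => i _; rewrite linearZ_LR -scalemxAr rowK mxE.
have S_Jb : semipositive (J + b^T *m p).
  exists x; split=> // i j; rewrite mulmxDl -mulmxA px0 mulmx0 addr0 mxE.
  rewrite big_ord_recl ltr_wpDr ?mxE ?mul1r ?x_gt0 //.
  by apply: sumr_ge0 => k _; rewrite mxE mul1r ltW.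
have := semipositive_mul_neq0 y_gt0 (L_semipos _ S_Jb).
by rewrite (linearD L) mulmxDr bD addrN eqxx.
Qed.

(** * Pencils of 2 x 2 matrices with a common row direction *)

Lemma proportional2 (F : fieldType) (a b c d : F) :
  (a, b) != (0, 0) -> a * d = b * c -> exists k, c = k * a /\ d = k * b.
Proof.
rewrite xpair_eqE negb_and; case: (eqVneq a 0) => [->|a_neq0] /= b_neq0 eq_ad.
  exists (d / b); rewrite divfK // mulr0; split=> //.
  by apply/eqP; move/eqP: eq_ad; rewrite mul0r eq_sym mulf_eq0 (negbTE b_neq0).
exists (c / a); rewrite divfK //; split=> //.
by apply: (mulfI a_neq0); rewrite eq_ad; field.
Qed.

(** The pencil spanned by [E0 = (a, b; c, d)] and [E1 = (e, f; g, h)].  The three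
    equations say that [det (y E0; y E1)], a quadratic form in [y], is zero.
    As [(a, b)] is nonzero, the first one makes the top row of [E1] equal to [k (a, b)], so that
    [E1 - k E0] has top row 0 and, by the mixed equation, bottom row
    [m (a, b)].  Independence excludes [m = 0], and then the remaining equation
    makes the bottom row of [E0] a multiple of [(a, b)] as well. *)
Lemma rank1_pencil_coef (F : fieldType) (a b c d e f g h : F) :
    a * f = b * e -> c * h = d * g -> a * h + c * f = b * g + d * e ->
    (a, b) != (0, 0) ->
    ~ (exists k, [/\ e = k * a, f = k * b, g = k * c & h = k * d]) ->
  exists c1 e0 e1, [/\ c = c1 * a, d = c1 * b, e = e0 * a, f = e0 * b
                     & g = e1 * a /\ h = e1 * b].
Proof.
move=> eq_ef eq_gh eq_mid ab_neq0 indep.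
have [k [e_def f_def]] := proportional2 ab_neq0 eq_ef.
have eq_m : a * (h - k * d) = b * (g - k * c).
  apply/eqP; rewrite -subr_eq0; apply/eqP.
  transitivity (a * h + c * f - (b * g + d * e)); last by rewrite eq_mid subrr.
  by rewrite e_def f_def; ring.
have [m [g_def h_def]] := proportional2 ab_neq0 eq_m.
have m_neq0 : m != 0.
  apply/eqP => m0; apply: indep; exists k.
  move: g_def h_def; rewrite m0 !mul0r => /eqP + /eqP.
  by rewrite !subr_eq0 => /eqP-> /eqP->.
have g_eq : g = m * a + k * c by rewrite -g_def subrK.
have h_eq : h = m * b + k * d by rewrite -h_def subrK.
have eq_cd : a * d = b * c.
  apply: (mulfI m_neq0); apply/eqP; rewrite -subr_eq0; apply/eqP.
  transitivity (d * g - c * h); last by rewrite eq_gh subrr.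
  by rewrite g_eq h_eq; ring.
have [c1 [c_def d_def]] := proportional2 ab_neq0 eq_cd.
exists c1, k, (m + k * c1); split=> //; split.
  by rewrite g_eq c_def; ring.
by rewrite h_eq d_def; ring.
Qed.

Lemma sum_ord2 (V : nmodType) (F : 'I_2 -> V) : \sum_i F i = F 0 + F 1.
Proof. by rewrite big_ord_recl big_ord1; congr (_ + F _); apply: val_inj. Qed.

Lemma ord2_ind (P : 'I_2 -> Prop) : P 0 -> P 1 -> forall i, P i.
Proof.
move=> P0 P1 [[|[|//]] lt_i2].
  by rewrite (_ : Ordinal _ = 0) //; apply: val_inj.
by rewrite (_ : Ordinal _ = 1) //; apply: val_inj.
Qed.

Lemma det_mx2 (R : comPzRingType) (A : 'M[R]_2) :
  \det A = A 0 0 * A 1 1 - A 0 1 * A 1 0.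
Proof.
rewrite (expand_det_row _ 0) sum_ord2 /cofactor !det_mx11 !mxE /= expr0 expr1.
rewrite (_ : lift 0 0 = 1); last exact: val_inj.
rewrite (_ : lift 1 0 = 0); last exact: val_inj.
by rewrite mul1r mulN1r mulrN.
Qed.

(** Spaces of singular [2 x 2] matrices have a common kernel or a common image.
    Applied to the maps [i |-> y E_i], a common kernel would be a linear
    relation between [E 0] and [E 1], so all the rows of both matrices lie on
    one line, that of [q]. *)
Lemma common_row_of_pencil (F : fieldType) (E : 'I_2 -> 'M[F]_2) :
    (forall s t, s *: E 0 + t *: E 1 = 0 -> s = 0 /\ t = 0) ->
    E 0 0 0 * E 1 0 1 = E 0 0 1 * E 1 0 0 ->
    E 0 1 0 * E 1 1 1 = E 0 1 1 * E 1 1 0 ->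
    E 0 0 0 * E 1 1 1 + E 0 1 0 * E 1 0 1
      = E 0 0 1 * E 1 1 0 + E 0 1 1 * E 1 0 0 ->
  exists (X : 'M[F]_2) (q : 'rV[F]_2), forall i, E i = col i X *m q.
Proof.
move=> indep eq00 eq11 eq01.
have scaled (A B : 'M[F]_2) k : [/\ B 0 0 = k * A 0 0, B 0 1 = k * A 0 1,
    B 1 0 = k * A 1 0 & B 1 1 = k * A 1 1] -> B = k *: A.
  by case=> ? ? ? ?; apply/matrixP; apply: ord2_ind; apply: ord2_ind; rewrite mxE.
have not_prop k : ~ [/\ E 1 0 0 = k * E 0 0 0, E 1 0 1 = k * E 0 0 1,
                       E 1 1 0 = k * E 0 1 0 & E 1 1 1 = k * E 0 1 1].
  move=> /scaled E1_def; have [|_ /eqP] := indep k (-1).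
    by rewrite E1_def scaleN1r subrr.
  by rewrite oppr_eq0 oner_eq0.
have not_prop' k : ~ [/\ E 0 0 0 = k * E 1 0 0, E 0 0 1 = k * E 1 0 1,
                        E 0 1 0 = k * E 1 1 0 & E 0 1 1 = k * E 1 1 1].
  move=> /scaled E0_def; have [|/eqP] := indep (-1) k.
    by rewrite E0_def scaleN1r addNr.
  by rewrite oppr_eq0 oner_eq0.
have [E0_row0|] := eqVneq (E 0 0 0, E 0 0 1) (0, 0); last first.
  move=> E0_neq0.
  have [c1 [e0 [e1 [h1 h2 h3 h4 [h5 h6]]]]] :=
    rank1_pencil_coef eq00 eq11 eq01 E0_neq0 (fun '(ex_intro k hk) => not_prop k hk).
  exists (\matrix_(i, j) if j == 0 then if i == 0 then 1 else c1
                          else if i == 0 then e0 else e1), (row 0 (E 0)).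
  apply: ord2_ind; apply/matrixP; apply: ord2_ind; apply: ord2_ind;
    by rewrite !mxE big_ord1 !mxE /= ?mul1r.
have [E1_row0|] := eqVneq (E 1 0 0, E 1 0 1) (0, 0); last first.
  move=> E1_neq0.
  have [|||c1 [e0 [e1 [h1 h2 h3 h4 [h5 h6]]]]] :=
    @rank1_pencil_coef _ _ _ (E 1 1 0) (E 1 1 1) (E 0 0 0) (E 0 0 1) (E 0 1 0)
      (E 0 1 1) _ _ _ E1_neq0 (fun '(ex_intro k hk) => not_prop' k hk).
  - by rewrite mulrC -eq00 mulrC.
  - by rewrite mulrC -eq11 mulrC.
  - transitivity (E 0 0 1 * E 1 1 0 + E 0 1 1 * E 1 0 0); first by ring.
    by rewrite -eq01; ring.
  exists (\matrix_(i, j) if j == 1 then if i == 0 then 1 else c1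
                          else if i == 0 then e0 else e1), (row 0 (E 1)).
  apply: ord2_ind; apply/matrixP; apply: ord2_ind; apply: ord2_ind;
    by rewrite !mxE big_ord1 !mxE /= ?mul1r.
(* Both top rows vanish: the bottom rows alone then give a linear relation. *)
case: E0_row0 => a0 b0; case: E1_row0 => e0 f0; exfalso.
have [[c0 d0]|cd_neq0] := eqVneq (E 0 1 0, E 0 1 1) (0, 0).
  by apply: (not_prop' 0); rewrite a0 b0 c0 d0 !mul0r.
have [k [hg hh]] := proportional2 cd_neq0 eq11.
by apply: (not_prop k); rewrite a0 b0 e0 f0 !mulr0.
Qed.

(** * The form of the preserver *)

(** [L] sends the matrices with row space spanned by [p] to matrices with one
    common row space: the vanishing of the determinant at all positive [y]
    gives the coefficientwise hypotheses of [common_row_of_pencil]. *)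
Lemma image_rank1 (R : realFieldType) (L : {linear 'M[R]_2 -> 'M[R]_2})
    (p : 'rV[R]_2) (x : 'cV[R]_2) :
    injective L -> (forall A, semipositive A -> semipositive (L A)) ->
    p != 0 -> mx_pos x -> p *m x = 0 ->
  exists (X : 'M[R]_2) (q : 'rV[R]_2), forall a, L (a *m p) = X *m a *m q.
Proof.
move=> L_inj L_semipos p_neq0 x_gt0 px0.
pose E (i : 'I_2) := L (delta_mx i 0 *m p).
have det_E s t : 0 < s -> 0 < t ->
    (s * E 0 0 0 + t * E 0 1 0) * (s * E 1 0 1 + t * E 1 1 1)
    - (s * E 0 0 1 + t * E 0 1 1) * (s * E 1 0 0 + t * E 1 1 0) = 0.
  move=> s_gt0 t_gt0; pose y : 'rV[R]_2 := \row_j if j == 0 then s else t.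
  have y_gt0 : mx_pos y by move=> i j; rewrite mxE; case: ifP.
  by rewrite -(det_pencil_eq0 L_semipos x_gt0 px0 y_gt0) det_mx2 !mxE !sum_ord2 !mxE.
have indep s t : s *: E 0 + t *: E 1 = 0 -> s = 0 /\ t = 0.
  have -> : s *: E 0 + t *: E 1
      = L ((s *: delta_mx 0 0 + t *: delta_mx 1 0 : 'cV_2) *m p).
    by rewrite mulmxDl -!scalemxAl (linearD L) !linearZ_LR.
  rewrite -(linear0 L) => /L_inj st0.
  have [k pk] : exists k, p 0 k != 0.
    apply/existsP; apply: contraNT p_neq0; rewrite negb_exists => /forallP p0.
    by apply/eqP/rowP => k; rewrite mxE; apply/eqP; rewrite -[_ == _]negbK p0.
  have st i := congr1 (fun M : 'M[R]_2 => M i k) st0.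
  by split; [have := st 0 | have := st 1];
    rewrite !mxE big_ord1 !mxE /= ?mulr0 ?mulr1 ?addr0 ?add0r => /eqP;
    rewrite mulf_eq0 (negbTE pk) orbF => /eqP.
(* A binary quadratic form is determined by its values at three pairwise
   non-proportional points, here (1, 1), (1, 2) and (2, 1). *)
have h11 := det_E 1 1 ltr01 ltr01.
have h12 := det_E 1 2 ltr01 (ltr0Sn _ _).
have h21 := det_E 2 1 (ltr0Sn _ _) ltr01.
have [X [q Eq]] : exists (X : 'M[R]_2) (q : 'rV[R]_2), forall i, E i = col i X *m q.
  by apply: common_row_of_pencil => //; clear -h11 h12 h21; lra.
exists X, q => a; rewrite mul_col_delta (linear_sum L) sum_ord2 !linearZ_LR.
rewrite -/(E 0) -/(E 1) !Eq !scalemxAl -mulmxDl; congr (_ *m _).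
by apply/colP => i; rewrite !mxE sum_ord2 mulrC [_ * X i 1]mulrC.
Qed.

(** With [p1], [p2] independent and [L(a p_i) = (X_i a) q_i], applying
    [image_rank1] to [p1 + p2] gives [(X a) q = (X1 a) q1 + (X2 a) q2].
    Surjectivity of [L] makes [q1], [q2] independent, so writing [q] in this
    basis as [w1 q1 + w2 q2] yields [X_i a = (X a) w_i]: all the left factors
    are multiples of the same [X]. *)
Lemma linear_eq_mulmx (R : realFieldType) (L : {linear 'M[R]_2 -> 'M[R]_2}) :
    bijective L -> (forall A, semipositive A -> semipositive (L A)) ->
  exists X Y : 'M[R]_2, [/\ X \in unitmx, Y \in unitmx
    & forall A, L A = X *m A *m Y].
Proof.
move=> L_bij L_semipos; have L_inj := bij_inj L_bij.
pose rw (s t : R) : 'rV[R]_2 := \row_j if j == 0 then s else t.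
pose cl (s t : R) : 'cV[R]_2 := \col_j if j == 0 then s else t.
have rw_image s t : 0 < s -> 0 < t ->
    exists (X : 'M[R]_2) (q : 'rV[R]_2), forall a, L (a *m rw s (- t)) = X *m a *m q.
  move=> s_gt0 t_gt0; apply: (@image_rank1 _ _ _ (cl t s)) => //.
  - apply/eqP => /rowP/(_ 0); rewrite !mxE /= => s0.
    by rewrite s0 ltxx in s_gt0.
  - by move=> i j; rewrite mxE; case: ifP.
  - by apply/matrixP => i j; rewrite !mxE sum_ord2 !mxE /=; ring.
(* The rows (2, -1), (1, -2) and their sum (3, -3) each have entries of
   opposite signs, hence a positive orthogonal vector. *)
have [X1 [q1 L1]] := rw_image 2 1 (ltr0Sn _ _) ltr01.
have [X2 [q2 L2]] := rw_image 1 2 ltr01 (ltr0Sn _ _).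
have [X [q LX]] := rw_image 3 3 (ltr0Sn _ _) (ltr0Sn _ _).
pose P := col_mx (rw 2 (-1)) (rw 1 (-2)) : 'M[R]_2.
pose Q := col_mx q1 q2 : 'M[R]_2.
have P_unit : P \in unitmx.
  rewrite unitmxE unitfE det_mx2.
  have P0 j : P 0 j = rw 2 (-1) 0 j.
    rewrite -(col_mxEu (rw 2 (-1)) (rw 1 (-2))).
    by apply: (congr1 (fun i : 'I_2 => P i j)); exact: val_inj.
  have P1 j : P 1 j = rw 1 (-2) 0 j.
    rewrite -(col_mxEd (rw 2 (-1)) (rw 1 (-2))).
    by apply: (congr1 (fun i : 'I_2 => P i j)); exact: val_inj.
  rewrite !P0 !P1 !mxE /= (_ : _ - _ = - 3%:R); last by ring.
  by rewrite oppr_eq0 pnatr_eq0.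
have row_split (M : 'M[R]_2) : exists a1 a2 : 'cV[R]_2, M = row_mx a1 a2.
  by exists (lsubmx (M : 'M_(2, 1 + 1))), (rsubmx (M : 'M_(2, 1 + 1))); rewrite hsubmxK.
have mul_rc m (a1 a2 : 'cV[R]_m) (r1 r2 : 'rV[R]_2) :
    (row_mx a1 a2 : 'M_(m, 2)) *m (col_mx r1 r2 : 'M_2) = a1 *m r1 + a2 *m r2.
  exact: (@mul_row_col _ m 1 1 2 a1 a2 r1 r2).
have L_P (a1 a2 : 'cV[R]_2) :
    L ((row_mx a1 a2 : 'M_2) *m P) = (row_mx (X1 *m a1) (X2 *m a2) : 'M_2) *m Q.
  by rewrite !mul_rc (linearD L) L1 L2.
have [L' _ L'K] := L_bij.
have Q_unit : Q \in unitmx.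
  have [a1 [a2 a_def]] := row_split (L' 1%:M *m invmx P).
  have := L_P a1 a2; rewrite -a_def mulmxKV // L'K => /esym/mulmx1_unit.
  by case.
have [w1 [w2 w_def]] : exists w1 w2 : 'M[R]_1, q *m invmx Q = row_mx w1 w2.
  by exists (lsubmx (q *m invmx Q : 'M_(1, 1 + 1))),
    (rsubmx (q *m invmx Q : 'M_(1, 1 + 1))); rewrite hsubmxK.
have L_same (a : 'cV[R]_2) : X1 *m a = X *m a *m w1 /\ X2 *m a = X *m a *m w2.
  apply: eq_row_mx; rewrite -mul_mx_row -w_def.
  apply: (can_inj (mulmxK Q_unit)).
  rewrite -[RHS]mulmxA mulmxKV // mul_rc -L1 -L2 -LX -(linearD L) -mulmxDr.
  by congr (L (_ *m _)); apply/rowP; apply: ord2_ind; rewrite !mxE /=; ring.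
have L_diag (M : 'M[R]_2) : L (M *m P) = X *m M *m (block_mx w1 0 0 w2 *m Q).
  have [a1 [a2 ->]] := row_split M; rewrite L_P mulmxA; congr (_ *m _).
  rewrite (@mul_mx_row _ 2 2 1 1 X a1 a2) (@mul_row_block _ 2 1 1 1 1) !mulmx0 addr0 add0r.
  by have [-> _] := L_same a1; have [_ ->] := L_same a2.
exists X, (invmx P *m (block_mx w1 0 0 w2 *m Q)).
have L_eq A : L A = X *m A *m (invmx P *m (block_mx w1 0 0 w2 *m Q)).
  by rewrite -{1}[A](mulmxKV P_unit) L_diag !mulmxA.
have := L_eq (L' 1%:M); rewrite L'K => /esym XAY1.
have [XA_unit Y_unit] := mulmx1_unit XAY1; split=> //.
by move: XA_unit; rewrite unitmx_mul => /andP[].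
Qed.

(** * Signs of the factors *)

(** A positive column with enough weight on the coordinate [k] makes its
    product with [r] positive. *)
Lemma rank1_semipositive (R : realFieldType) (m n : nat) (a : 'cV[R]_m)
    (r : 'rV[R]_n) (k : 'I_n) :
  mx_pos a -> 0 < r 0 k -> semipositive (a *m r).
Proof.
move=> a_gt0 rk_gt0; pose s := \sum_j r 0 j.
pose N := (`|s| + 1) / r 0 k.
have N_gt0 : 0 < N by rewrite divr_gt0 // ltr_wpDl.
exists (const_mx 1 + N *: delta_mx k 0); split=> i j.
  by rewrite !mxE ltr_pwDl // mulr_ge0 ?ler0n // ltW.
rewrite -mulmxA mxE big_ord1 pmulr_rgt0 ?a_gt0 // mulmxDr -scalemxAr -colE !mxE.
under eq_bigr => l _ do rewrite mxE mulr1.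
rewrite !ord1 divfK ?gt_eqF // -/s.
by have := ler_norm (- s); rewrite normrN; lra.
Qed.

Lemma semipositive_rank1 (R : numDomainType) (m n : nat) (b : 'cV[R]_m) (s : 'rV[R]_n) :
  semipositive (b *m s) -> exists c, forall i, 0 < b i 0 * c.
Proof.
move=> [u [_ bsu_gt0]]; exists ((s *m u) 0 0) => i.
by have := bsu_gt0 i 0; rewrite -mulmxA mxE big_ord1.
Qed.

(** The image of [a 1], with [1] the all-ones row, is the rank-one matrix
    [(X a) (1 Y)]; at a positive column it evaluates to a multiple of [X a]. *)
Lemma image_pos_same_sign (R : realFieldType) (m n : nat) (X : 'M[R]_m.+1)
    (Y : 'M[R]_n.+1) (a : 'cV[R]_m.+1) :
    (forall A, semipositive A -> semipositive (X *m A *m Y)) -> mx_pos a ->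
  exists c, forall i, 0 < (X *m a) i 0 * c.
Proof.
move=> XY_semipos a_gt0.
have := XY_semipos _ (@rank1_semipositive _ _ _ a (const_mx 1) 0 a_gt0 _).
rewrite mulmxA -mulmxA => /(_ _)/semipositive_rank1; apply.
by rewrite mxE.
Qed.

(** Both signs are detected by rank-one matrices: [X] by the images of positive
    columns, and [invmx Y] by the row [r = - row i (invmx Y)], for which [r Y]
    is minus a basis vector. *)
Lemma signs_of_preserver (R : realFieldType) (m n : nat) (X : 'M[R]_m.+1)
    (Y : 'M[R]_n.+1) :
    (forall A, semipositive A -> semipositive (X *m A *m Y)) ->
    Y \in unitmx -> mx_pos (X *m (const_mx 1 : 'cV[R]_m.+1)) ->
  row_positive X /\ inverse_nonneg Y.
Proof.
move=> XY_semipos Y_unit; set o : 'cV[R]_m.+1 := const_mx 1 => Xo_gt0.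
have o_gt0 : mx_pos o by move=> i j; rewrite mxE.
split; last first.
  split=> // i j; rewrite leNgt; apply/negP => Yij_lt0.
  have [|u [u_gt0]] :=
    XY_semipos _ (@rank1_semipositive _ _ _ o (- row i (invmx Y)) j o_gt0 _).
    by rewrite !mxE oppr_gt0.
  rewrite !mulmxA -(mulmxA (X *m o)) mulNmx -row_mul mulVmx // row1.
  move=> /(_ 0 0); rewrite mulmxN mulNmx -mulmxA -rowE mxE mxE big_ord1.
  by rewrite [row i u _ _]mxE oppr_gt0 ltNge ltW // mulr_gt0.
split=> [i j|i].
  rewrite leNgt; apply/negP => Xij_lt0.
  (* This weight on the coordinate j cancels the i-th entry of X a, although
     a = o + N e_j is positive. *)
  pose N := - (X *m o) i 0 / X i j.
  have N_gt0 : 0 < N by rewrite nmulr_lgt0 ?invr_lt0 // oppr_lt0.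
  have [|c /(_ i)] := @image_pos_same_sign _ _ _ X Y (o + N *: delta_mx j 0) XY_semipos.
    by move=> k l; rewrite !mxE ltr_pwDl // mulr_ge0 ?ler0n // ltW.
  have -> : (X *m (o + N *: delta_mx j 0)) i 0 = (X *m o) i 0 + N * X i j.
    by rewrite mulmxDr -scalemxAr -colE mxE; congr (_ + _); rewrite !mxE.
  by rewrite divfK ?lt_eqF // subrr mul0r ltxx.
apply/existsP; apply: contraTT (Xo_gt0 i 0).
rewrite negb_exists => /forallP Xi0; rewrite -leNgt mxE big1 // => j _.
by move: (Xi0 j); rewrite negbK => /eqP->; rewrite mul0r.
Qed.

Theorem theorem3p3 (R : realType) (L : {linear 'M[R]_2 -> 'M[R]_2})
    (L_inv : bijective L)
    (L_semipos : L @` semipositives R 2 `<=` semipositives R 2) :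
  exists X Y : 'M[R]_2,
    [/\ X \in unitmx, row_positive X, inverse_nonneg Y
      & forall A : 'M[R]_2, L A = X *m A *m Y].
Proof.
have L_sp A : semipositive A -> semipositive (L A).
  by move=> A_sp; apply: L_semipos; exists A.
have [X [Y [X_unit Y_unit L_eq]]] := linear_eq_mulmx L_inv L_sp.
have XY_sp A : semipositive A -> semipositive (X *m A *m Y).
  by move=> /L_sp; rewrite L_eq.
have [|c Xo_c] := @image_pos_same_sign _ _ _ X Y (const_mx 1) XY_sp.
  by move=> i j; rewrite mxE.
have c_neq0 : c != 0 by apply: contraTneq (Xo_c 0) => ->; rewrite mulr0 ltxx.
have [c_gt0|c_le0] := ltP 0 c.
  have [|X_pos Y_inv] := signs_of_preserver XY_sp Y_unit.
    by move=> i j; rewrite ord1 -(pmulr_lgt0 _ c_gt0).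
  by exists X, Y.
have c_lt0 : c < 0 by rewrite lt_neqAle c_neq0.
have NXY A : - X *m A *m - Y = X *m A *m Y by rewrite mulmxN !mulNmx opprK.
have [|||X_pos Y_inv] := @signs_of_preserver _ _ _ (- X) (- Y).
- by move=> A /XY_sp; rewrite NXY.
- by rewrite -scaleN1r unitmxZ // unitrN unitr1.
- move=> i j; rewrite ord1 mulNmx mxE oppr_gt0.
  by rewrite -(nmulr_lgt0 _ c_lt0).
exists (- X), (- Y); split=> //; last by move=> A; rewrite NXY.
by rewrite -scaleN1r unitmxZ // unitrN unitr1.
Qed.
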